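(* Let $G$ be a finite nilpotent group. The following are equivalent: (1) $G$ is quasi-Leinster; (2) $G$ is cyclic and $|G|$ is quasi-perfect.
   Context: For a positive integer $n$ let $D(n)=\sum_{d\mid n} d$ be the sum of all positive divisors of $n$. The integer $n$ is quasi-perfect if $D(n)=2n+1$. For a finite group $G$ let $D(G)=\sum_{N\trianglelefteq G}|N|$, the sum of the orders of all normal subgroups of $G$ (including the trivial subgroup and $G$ itself). The group $G$ is quasi-Leinster if $D(G)=2|G|+1$. *)

(* Defs.v *)
From mathcomp Require Import all_boot all_fingroup all_solvable.

Set Implicit Arguments.
Unset Strict Implicit.
Unset Printing Implicit Defensive.

Definition divisor_sum (n : nat) : nat := \sum_(d <- divisors n) d.

(* [divisors 0] is empty, so [quasi_perfect 0] fails: only positive integers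
   can be quasi-perfect. *)
Definition quasi_perfect (n : nat) : Prop := divisor_sum n = 2 * n + 1.

Definition normal_order_sum (gT : finGroupType) (G : {group gT}) : nat :=
  \sum_(N : {group gT} | (N <| G)%g) #|N|.

Definition quasi_Leinster (gT : finGroupType) (G : {group gT}) : Prop :=
  normal_order_sum G = 2 * #|G| + 1.

(* Main.v *)
(** For cyclic [G] the subgroups correspond to the divisors of [#|G|], so the
    two sums agree.  Conversely, the sum of the orders of the normal subgroups
    counts, for each [x] in [G], the normal subgroups containing [x].  If [G]
    is nilpotent and not cyclic, every [x] lies in [G] and in a maximal (hence
    normal) subgroup, which gives at least two; the identity lies in [1], [G]
    and two distinct nontrivial maximal subgroups, which gives at least four.
    Thus the sum is at least [2 * #|G| + 2]. *)

Require Import Defs.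
From mathcomp Require Import all_boot all_fingroup all_solvable.

Lemma normal_order_sum_cyclic (gT : finGroupType) (G : {group gT}) :
  cyclic G -> normal_order_sum G = divisor_sum #|G|.
Proof.
move=> cycG; have nsG (N : {group gT}) : (N <| G)%g = (N \subset G).
  by rewrite (sub_abelian_normal _ (cyclic_abelian cycG)).
rewrite /normal_order_sum /divisor_sum (eq_bigl _ _ nsG) -big_enum.
rewrite -(big_map (fun N : {group gT} => #|N|) xpredT id) /=.
(* It suffices that the list of subgroup orders and the list of divisors are duplicate-free with the
   same members. The former has no repetition because subgroups of a cyclic group are determined by
   their order. *)
apply/perm_big/uniq_perm; last 1 first.
- move=> d; rewrite -dvdn_divisors ?cardG_gt0 //.
  apply/mapP/idP=> [[N] | ].
    by rewrite mem_enum => sNG ->; apply: cardSg.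
  case/cyclicP: cycG => a -> d_dv.
  (* This power of the generator has order [d], so every divisor is attained. *)
  have: <[a ^+ (#[a]%g %/ d)]>%G
      \in [set H : {group gT} | H \subset <[a]> & #|H| == d]%g.
    by rewrite cycle_sub_group // set11.
  rewrite inE => /andP[sHa /eqP dE].
  exists <[a ^+ (#[a]%g %/ d)]>%G; last by rewrite dE.
  by rewrite mem_enum.
- rewrite map_inj_in_uniq ?enum_uniq // => H K.
  rewrite !mem_enum => sHG sKG eqHK.
  by apply/val_inj/eqP; rewrite /= (eq_subG_cyclic cycG) ?eqHK.
- exact: divisors_uniq.
Qed.

Lemma normal_order_sum_count (gT : finGroupType) (G : {group gT}) :
  normal_order_sum G =
    \sum_(x in G) #|[set N : {group gT} | (N <| G)%g & x \in N]|.
Proof.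
transitivity (\sum_(N : {group gT} | (N <| G)%g) \sum_(x in N) 1).
  by apply: eq_bigr => N _; rewrite sum1_card.
rewrite (exchange_big_dep (mem G)) /=; last first.
  by move=> N x /normal_sub/subsetP; apply.
by apply: eq_bigr => x _; rewrite sum1dep_card.
Qed.

(** By maximality ['N_G(M)] is [G] or [M]; the latter is impossible, as a proper subgroup of a
    nilpotent group is strictly smaller than its normalizer. *)
Lemma nilpotent_maximal_normal (gT : finGroupType) (G M : {group gT}) :
  nilpotent G -> maximal M G -> (M <| G)%g.
Proof.
move=> nilG /maxgroupP[/andP[sMG sGM] maxM]; rewrite /normal sMG.
have: 'N_G(M)%g \subset G by apply: subsetIl.
rewrite subEproper => /predU1P[/setIidPl-> // | /maxM sNM].
case/negP: sGM; rewrite (nilpotent_sub_norm nilG sMG) //.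
by rewrite sNM // subsetI sMG normG.
Qed.

(** Since [G] is not cyclic, [<[x]>] is proper and so lies in a maximal subgroup. *)
Lemma noncyclic_mem_normal (gT : finGroupType) (G : {group gT}) (x : gT) :
  nilpotent G -> ~~ cyclic G -> x \in G ->
  exists2 N : {group gT}, (N <| G)%g & (N \proper G) && (x \in N).
Proof.
move=> nilG ncycG Gx.
have [defG | [M maxM sxM]] : _ \/ _ := maximal_exists (G := G) (H := <[x]>%G)
    (etrans (cycle_subG x G) Gx).
  by case/cyclicP: ncycG; exists x.
exists M; first exact: nilpotent_maximal_normal maxM.
by rewrite (maxgroupp maxM) -cycle_subG.
Qed.

Lemma normal_order_sum_noncyclic (gT : finGroupType) (G : {group gT}) :
  nilpotent G -> ~~ cyclic G -> 2 * #|G| + 2 <= normal_order_sum G.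
Proof.
move=> nilG ncycG; rewrite normal_order_sum_count.
have ntG : G :!=: 1%g by apply: contraNneq ncycG => ->; apply: cyclic1.
have two x : x \in G ->
    2 <= #|[set N : {group gT} | (N <| G)%g & x \in N]|.
  move=> Gx; have [N nsN /andP[ltN Nx]] := noncyclic_mem_normal _ _ _ nilG ncycG Gx.
  rewrite (cardsD1 G) (cardsD1 N) !inE normal_refl Gx nsN Nx.
  by rewrite -val_eqE /= (proper_neq ltN).
have four : 4 <= #|[set N : {group gT} | (N <| G)%g & 1%g \in N]|.
  have [x Gx ntx] := trivgPn _ ntG.
  have [M nsM /andP[ltM Mx]] := noncyclic_mem_normal _ _ _ nilG ncycG Gx.
  (* Choosing [y] outside [M] makes [K] both nontrivial and different from [M]. *)
  have [_ [y Gy notMy]] := properP ltM.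
  have [K nsK /andP[ltK Ky]] := noncyclic_mem_normal _ _ _ nilG ncycG Gy.
  have ntM : M != 1%G :> {group gT}.
    by apply: contraNneq ntx => M1; rewrite M1 inE in Mx.
  have ntK : K != 1%G :> {group gT}.
    by apply: contraNneq notMy => K1; move: Ky; rewrite K1 inE => /eqP->.
  have neKM : K != M by apply: contraNneq notMy => <-.
  have neMG : M != G by rewrite -val_eqE /= (proper_neq ltM).
  have neKG : K != G by rewrite -val_eqE /= (proper_neq ltK).
  rewrite (cardsD1 G) (cardsD1 M) (cardsD1 K) (cardsD1 1%G) !inE.
  rewrite normal_refl normal1 nsM nsK !group1 neMG neKG neKM.
  by rewrite !eqxx (eq_sym 1%G K) (eq_sym 1%G M) (eq_sym 1%G G) ntM ntK (ntG : G != 1%G).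
(* The bound splits as 4 for the identity plus 2 for each of the other [#|G| - 1] elements. *)
rewrite (bigD1 1%g) //= (cardsD1 1%g) group1 mulnDr addnAC.
apply: leq_add => //; rewrite mulnC -sum_nat_const.
rewrite [leqRHS](eq_bigl (mem (G :\ 1%g))); last first.
  by move=> x; rewrite !inE andbC.
by apply: leq_sum => x /setD1P[_ Gx]; apply: two.
Qed.

Theorem proposition2p3 (gT : finGroupType) (G : {group gT}) (nilG : nilpotent G) :
  quasi_Leinster G <-> cyclic G /\ quasi_perfect #|G|.
Proof.
rewrite /quasi_Leinster /quasi_perfect.
split=> [QL | [cycG <-]]; last by rewrite normal_order_sum_cyclic.
have cycG : cyclic G.
  apply: contraT => ncycG; have := normal_order_sum_noncyclic _ _ nilG ncycG.
  by rewrite QL leq_add2l.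
by rewrite -normal_order_sum_cyclic.
Qed.
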